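(* A map is orientable if and only if it has an $R$-coloring, where $R=\{0,1,2\}$.
   Context: Map. A map $\mathcal{M}$ is an embedding of a graph (or pseudograph) on a compact connected surface such that the components of the complement (faces) are open disks. Choose a center in each face and a midpoint in each edge, and join each face-center to each incidence with the surrounding vertices and edge-midpoints; this divides the surface into triangles called flags. Combinatorially, a map is a pair $(\Omega,[r_0,r_1,r_2])$ where $\Omega$ is the (finite, since the surface is compact) set of flags, $r_0,r_1,r_2$ are permutations of $\Omega$ (acting on the right), $r_0,r_1,r_2$ and $r_0r_2$ are fixed-point-free of order 2, $r_0r_2=r_2r_0$, and $\langle r_0,r_1,r_2\rangle$ is transitive on $\Omega$. Here $fr_0$, $fr_1$, $fr_2$ are the flags sharing with $f$ the side joining edge-midpoint to face-center, the side joining face-center to vertex, and the side joining vertex to edge-midpoint, respectively; the surface is recovered by taking one triangle for each flag and gluing along these sides. Orientable. A map is orientable if the surface on which it is embedded is orientable; equivalently, if it has a face orientation, i.e. an assignment of a circular arrow (direction of rotation) to each face such that at every edge the arrows on the faces joined by the edge point along the edge in opposite directions. Coloring. An $R$-coloring of $\mathcal{M}$ is a function $a:\Omega\to\mathbb{Z}_2$ such that $a(fr_j)\neq a(f)$ for every flag $f$ and every $j\in\{0,1,2\}$. *)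

(* Defs.v *)
From HB Require Import structures.
From mathcomp Require Import all_boot all_order all_fingroup all_algebra.

Set Implicit Arguments.
Unset Strict Implicit.
Unset Printing Implicit Defensive.

Local Open Scope group_scope.

(* [(s * t) f = t (s f)] in [{perm T}], so [r0 * r2] is the product for the
   right action, [f r_j] being written [r_j f].  The conditions on orders
   force the flag set to be nonempty. *)
Record flag_map := FlagMap {
  flag :> finType;
  r0 : {perm flag};
  r1 : {perm flag};
  r2 : {perm flag};
  r0_order : #[r0] = 2;
  r1_order : #[r1] = 2;
  r2_order : #[r2] = 2;
  r02_order : #[r0 * r2] = 2;
  r0_free : forall f, r0 f != f;
  r1_free : forall f, r1 f != f;
  r2_free : forall f, r2 f != f;
  r02_free : forall f, (r0 * r2) f != f;
  r02_comm : r0 * r2 = r2 * r0;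
  monodromy_trans : [transitive <<[set r0; r1; r2]>>, on [set: flag] | 'P]
}.

Definition r (M : flag_map) (j : 'I_3) : {perm M} :=
  tnth [tuple r0 M; r1 M; r2 M] j.

Definition face (M : flag_map) (f : M) : {set M} :=
  orbit 'P <<[set r0 M; r1 M]>> f.

Definition faces (M : flag_map) : {set {set M}} := [set face f | f : M].

(* The flags [f] and [r0 f] form one side of the boundary polygon of a face;
   [f] also stands for that side directed from the end at the vertex of [f]
   to the end at the vertex of [r0 f].  The directed side that follows it in
   a walk around the face is [r1 (r0 f)], so a direction of rotation of a
   face is a cycle of [r0 * r1] contained in it. *)
Definition circular_arrow (M : flag_map) (F C : {set M}) : bool :=
  (C \in porbits (r0 M * r1 M)) && (C \subset F).

(* The arrow of the face containing [f] runs along the edge of [f], on the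
   side of [f], from the end of the edge at [f] to its other end. *)
Definition points_along (M : flag_map) (rho : {set M} -> {set M}) (f : M) : bool :=
  f \in rho (face f).

(* The other side of the edge of [f] consists of [r2 f], at the same end of
   the edge as [f], and [r2 (r0 f)], at the same end as [r0 f].  The two
   sides may belong to the same face. *)
Definition face_orientation (M : flag_map) (rho : {set M} -> {set M}) : Prop :=
  (forall F, F \in faces M -> circular_arrow F (rho F)) /\
  (forall f : M, points_along rho f -> points_along rho (r2 M (r0 M f))).

Definition orientable (M : flag_map) : Prop :=
  exists rho : {set M} -> {set M}, face_orientation rho.

Definition R_coloring (M : flag_map) (a : M -> 'Z_2) : Prop :=
  forall (f : M) (j : 'I_3), a (r M j f) <> a f.

(* Main.v *)
Require Import Defs.
From mathcomp Require Import all_boot all_order all_fingroup all_algebra.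

(** Write [s = r0 * r1] for one step around a face.  Since [r0] and [r1] are
    involutions, the [s]-cycle [C] of a flag [c], together with the flags [f]
    such that [r0 f] lies in [C], is stable under [r0] and [r1], hence exhausts
    the face of [c] ([face_halves]).  The two halves are disjoint
    ([cycle_r0_disjoint]): [r0] inverts [s], so if [r0 f] were [s^k f], then the
    middle of the walk from [f] to [r0 f] would give a fixed point of [r0] ([k]
    even) or of [r1] ([k] odd).  So each face is cut into two directed boundary
    cycles exchanged by [r0] and by [r1], and a choice of arrow on each face is
    the same thing as a two-coloring of the flags that changes along [r0] and
    [r1], the arrow being the cycle of color 1.  The compatibility condition at
    the edges says that [r2 (r0 f)] has the color of [f], that is, that the
    color also changes along [r2]. *)

Set Implicit Arguments.
Unset Strict Implicit.
Unset Printing Implicit Defensive.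

Local Open Scope group_scope.

Section Flags.

Variable M : flag_map.
Implicit Types f c : M.

Local Notation s := (r0 M * r1 M).

Lemma order2K (T : finType) (p : {perm T}) : #[p] = 2 -> involutive p.
Proof. by move=> p2 x; rewrite -permM -expg2 -p2 expg_order perm1. Qed.

Lemma r0K : involutive (r0 M).
Proof. exact: order2K (r0_order M). Qed.

Lemma r1K : involutive (r1 M).
Proof. exact: order2K (r1_order M). Qed.

Lemma r2K : involutive (r2 M).
Proof. exact: order2K (r2_order M). Qed.

Lemma r02C f : r2 M (r0 M f) = r0 M (r2 M f).
Proof. by rewrite -!permM r02_comm. Qed.

Lemma mem_cycle_step c f : (s f \in porbit s c) = (f \in porbit s c).
Proof. by rewrite -!eq_porbit_mem -(porbit_perm _ 1 f) expg1. Qed.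

(** [r0] reverses the walk around a face. *)
Lemma iter_step_r0 k f : iter k s (r0 M (iter k s f)) = r0 M f.
Proof.
elim: k f => //= k IHk f.
by rewrite -iterS iterSr !permM r0K r1K IHk.
Qed.

Lemma cycle_r0_disjoint c f : f \in porbit s c -> r0 M f \notin porbit s c.
Proof.
rewrite -eq_porbit_mem => /eqP <-; apply/negP => /porbitP[k].
rewrite permX => eq_k.
have iter_inj i : injective (iter i s).
  by elim: i => //= i IHi x y /perm_inj /IHi.
have := odd_double_half k; move: (k./2) => j; case: (odd k) => def_k.
  (* [k = 2j + 1]: with [g = s^j f], the flag [r0 g] is fixed by [r1]. *)
  have: iter j s (r0 M (iter j s f)) = iter j s (s (iter j s f)).
    by rewrite iter_step_r0 eq_k -def_k add1n -addnn -addnS iterD.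
  move/iter_inj; rewrite permM => /esym fix1.
  by have := r1_free (r0 M (iter j s f)); rewrite fix1 eqxx.
(* [k = 2j]: the flag [s^j f] is fixed by [r0]. *)
have: iter j s (r0 M (iter j s f)) = iter j s (iter j s f).
  by rewrite iter_step_r0 eq_k -def_k -addnn -iterD.
by move/iter_inj => fix0; have := r0_free (iter j s f); rewrite fix0 eqxx.
Qed.

Lemma face_refl f : f \in face f.
Proof. exact: orbit_refl. Qed.

Lemma face_eq c f : c \in face f -> face c = face f.
Proof. by move=> cf; apply: orbit_eqP cf. Qed.

Lemma face_r0 f : face (r0 M f) = face f.
Proof. by apply/face_eq/(@mem_orbit _ _ _ 'P)/mem_gen; rewrite !inE eqxx. Qed.

Lemma face_r1 f : face (r1 M f) = face f.
Proof.
by apply/face_eq/(@mem_orbit _ _ _ 'P)/mem_gen; rewrite !inE eqxx orbT.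
Qed.

Lemma cycle_sub_face f : porbit s f \subset face f.
Proof.
apply/subsetP => _ /porbitP[k ->]; rewrite permX.
elim: k => [|k IHk]; first exact: face_refl.
by rewrite iterS permM -(face_eq IHk) -face_r0 -face_r1 face_refl.
Qed.

Lemma face_halves c f :
  f \in face c -> (f \in porbit s c) || (r0 M f \in porbit s c).
Proof.
pose D := [set g | (g \in porbit s c) || (r0 M g \in porbit s c)].
suff stabD: <<[set r0 M; r1 M]>> \subset 'N(D | 'P).
  case/orbitP => p /(subsetP stabD)/astabs_act pD <-.
  have: c \in D by rewrite inE porbit_id.
  by rewrite -pD inE.
rewrite gen_subG; apply/subsetP => p; rewrite !inE => /orP[] /eqP ->;
  apply/subsetP => g; rewrite !inE /= apermE.
  by rewrite r0K orbC.
case/orP=> gC; apply/orP; [right | left].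
  by rewrite -mem_cycle_step permM r0K r1K.
by rewrite -mem_cycle_step permM r0K in gC.
Qed.

(** The arrow of a face contains exactly one of [f] and [r0 f]. *)
Lemma arrow_r0 f (C : {set M}) :
  circular_arrow (face f) C -> (r0 M f \in C) = (f \notin C).
Proof.
case/andP=> /imsetP[c _ ->] /subsetP/(_ c (porbit_id _ _))/face_eq def_f.
have := face_refl f; rewrite -def_f => /face_halves.
by case: (boolP (f \in _)) => [/cycle_r0_disjoint/negPf | _].
Qed.

Lemma arrow_step (F C : {set M}) f :
  circular_arrow F C -> (s f \in C) = (f \in C).
Proof. by case/andP=> /imsetP[c _ ->] _; rewrite mem_cycle_step. Qed.

Section Orientation.

Variable rho : {set M} -> {set M}.
Hypothesis rhoP : face_orientation rho.

Lemma orientation_arrow f : circular_arrow (face f) (rho (face f)).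
Proof. by case: rhoP => arrow _; apply/arrow/imset_f. Qed.

Lemma points_along_r0 f : points_along rho (r0 M f) = ~~ points_along rho f.
Proof. by rewrite /points_along face_r0 arrow_r0 ?orientation_arrow. Qed.

Lemma points_along_r1 f : points_along rho (r1 M f) = ~~ points_along rho f.
Proof.
rewrite -points_along_r0 /points_along face_r0 face_r1.
by rewrite -(arrow_step (r0 M f) (orientation_arrow f)) permM r0K.
Qed.

Lemma points_along_r2 f : points_along rho (r2 M f) = ~~ points_along rho f.
Proof.
have [_ along] := rhoP; rewrite -points_along_r0.
(* [r2 * r0] is an involution, so the edge condition is an equivalence. *)
apply/idP/idP => /along; last by rewrite r0K.
by rewrite -r02C r2K.
Qed.

End Orientation.

Lemma orientable_coloring : orientable M -> exists a : M -> 'Z_2, R_coloring a.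
Proof.
case=> rho rhoP; exists (fun f => (points_along rho f : nat)%:R)%R.
move=> f [[|[|[|//]]] ltj]; rewrite /r (tnth_nth (r0 M)) /=.
- by rewrite points_along_r0 //; case: points_along.
- by rewrite points_along_r1 //; case: points_along.
- by rewrite points_along_r2 //; case: points_along.
Qed.

Section Coloring.

Variable a : M -> 'Z_2.
Hypothesis aP : R_coloring a.

Lemma Z2_neq (x y : 'Z_2) : x <> y -> (x == 1%R) = (y != 1%R).
Proof.
by case: x y => [[|[|//]] ltx] [[|[|//]] lty] neq //; case: neq; apply: val_inj.
Qed.

Lemma coloring_r0 f : (a (r0 M f) == 1%R) = (a f != 1%R).
Proof. by apply/Z2_neq; have := @aP f (@Ordinal 3 0 isT). Qed.

Lemma coloring_r1 f : (a (r1 M f) == 1%R) = (a f != 1%R).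
Proof. by apply/Z2_neq; have := @aP f (@Ordinal 3 1 isT). Qed.

Lemma coloring_r2 f : (a (r2 M f) == 1%R) = (a f != 1%R).
Proof. by apply/Z2_neq; have := @aP f (@Ordinal 3 2 isT). Qed.

Lemma coloring_cycle c f : f \in porbit s c -> (a f == 1%R) = (a c == 1%R).
Proof.
case/porbitP=> k ->; rewrite permX; elim: k => //= k <-.
by rewrite permM coloring_r1 coloring_r0 negbK.
Qed.

(** The direction of rotation of a face [F] formed by its flags of color 1: the
    cycle of any one of them.  The value [set0] does not arise for a face, since
    [r0] changes the color. *)
Definition coloring_arrow (F : {set M}) : {set M} :=
  if [pick c in F | a c == 1%R] is Some c then porbit s c else set0.

Lemma coloring_arrowP f :
  exists c, [/\ coloring_arrow (face f) = porbit s c,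
                c \in face f & a c == 1%R].
Proof.
rewrite /coloring_arrow; case: pickP => [c /andP[cf c1] | none].
  by exists c.
have := none (r0 M f); have := none f.
by rewrite -{2}face_r0 !face_refl /= coloring_r0 => ->.
Qed.

Lemma points_along_coloring f : points_along coloring_arrow f = (a f == 1%R).
Proof.
rewrite /points_along; have [c [-> /face_eq def_f c1]] := coloring_arrowP f.
apply/idP/idP => [/coloring_cycle -> // | f1].
have := face_refl f; rewrite -def_f => /face_halves /orP[// | /coloring_cycle].
by rewrite coloring_r0 f1 c1.
Qed.

Lemma coloring_orientable : orientable M.
Proof.
exists coloring_arrow; split=> [_ /imsetP[f _ ->] | f].
  have [c [-> cf _]] := coloring_arrowP f.
  by rewrite /circular_arrow imset_f //= -(face_eq cf) cycle_sub_face.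
by rewrite !points_along_coloring coloring_r2 coloring_r0 negbK.
Qed.

End Coloring.

End Flags.

Theorem proposition5p1 (M : flag_map) :
  orientable M <-> exists a : M -> 'Z_2, R_coloring a.
Proof.
split; first exact: orientable_coloring.
by case=> a; apply: coloring_orientable.
Qed.
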